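(* Consider a cyclic pursuit of $n\ge2$ unicycles without overlap, with relative coordinates $(\rho_i,\alpha_i,\beta_i)$, $i\in\mathcal I=\{1,\ldots,n\}$ (which always satisfy the coordinate constraints $g_1=g_2=0$ and $g_3=0 \bmod 2\pi$). A circular formation is realized if and only if the following extra conditions hold: $$2\alpha_i+\beta_i=\pi \bmod 2\pi,\quad \forall i\in\mathcal I,$$ $$\frac{2\sin\alpha_i}{\rho_i}=\frac1r\neq 0,\quad\forall i\in\mathcal I,$$ for some $r$ (common to all $i$), where $|r|\in(0,+\infty)$ is equal to the radius of the circle. The unicycles rotate at angular speed $v/r$, counterclockwise for $r>0$ and clockwise for $r<0$.
   Context: Each unicycle $i\in\mathcal I=\{1,\ldots,n\}$ has position $z_i=[x_i,y_i]^\top$ and heading $\theta_i$, with $\dot x_i=v\cos\theta_i$, $\dot y_i=v\sin\theta_i$, $\dot\theta_i=\omega_i$, where $v>0$ is a fixed common forward speed. In cyclic pursuit, unicycle $i$ pursues unicycle $i+1$ (indices modulo $n$). ''Without overlap'' means $z_i\neq z_j$ for $i\ne j$. Relative coordinates: $\rho_i>0$ is the distance between $i$ and $i+1$; $\alpha_i$ is the bearing, i.e. the (counterclockwise) angle from $i$'s heading to the direction of $z_{i+1}-z_i$; and $\beta_i=\theta_i-\theta_{i+1}-\pi$. (Angles are considered modulo $2\pi$; equivalently $\alpha_i+\beta_i$ is the bearing from $i+1$'s heading to the direction of $z_i-z_{i+1}$.) Coordinate constraints: with $\gamma_i=(i-1)\pi-\sum_{j=1}^{i-1}\beta_j$, $g_1=\sum_{i=1}^n\rho_i\sin(\alpha_i+\gamma_i)$,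 $g_2=\sum_{i=1}^n\rho_i\cos(\alpha_i+\gamma_i)$, $g_3=\sum_{i=1}^n\beta_i+n\pi$. Circular formation: the unicycles travel along a common circle at the same angular speed. At the level of positions and headings this means that there is a circle (of finite positive radius) containing all positions $z_i$, such that each heading vector $[\cos\theta_i,\sin\theta_i]^\top$ is tangent to the circle at $z_i$ and all headings point in the same rotation direction. *)

(* Defs.v *)
From HB Require Import structures.
From mathcomp Require Import all_boot all_order all_algebra.
From mathcomp Require Import all_classical all_reals all_analysis.

Set Implicit Arguments.
Unset Strict Implicit.
Unset Printing Implicit Defensive.

Import Order.TTheory GRing.Theory Num.Theory.
Import numFieldNormedType.Exports.
Local Open Scope classical_set_scope.
Local Open Scope ring_scope.

(* The unicycles 1, ..., n are indexed from 0 by i : 'I_n; unicycle i pursues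
   ordS i, whose value is (i + 1) mod n. *)

Definition eq_mod2pi (R : realType) (a b : R) : Prop :=
  exists k : int, a - b = k%:~R * (2 * pi).

Definition unicycle_dynamics (R : realType) (v : R) (x y theta omega : R -> R)
    (t : R) : Prop :=
  [/\ is_derive t (1 : R) x (v * cos (theta t)),
      is_derive t (1 : R) y (v * sin (theta t))
    & is_derive t (1 : R) theta (omega t)].

Section Configuration.
Variables (R : realType) (n : nat).

(* A configuration at one instant: x, y are the positions and theta the
   headings. *)
Implicit Types x y theta rho alpha beta : 'I_n -> R.

Definition without_overlap x y : Prop :=
  forall i j : 'I_n, i != j -> (x i, y i) <> (x j, y j).

(* The bearing alpha i is pinned modulo 2 pi by the polar form of
   z_(i+1) - z_i in the direction theta i + alpha i; any representative of the
   angles alpha i and beta i is allowed. *)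
Definition relative_coordinates x y theta rho alpha beta : Prop :=
  forall i : 'I_n,
    [/\ 0 < rho i,
        rho i = Num.sqrt ((x (ordS i) - x i) ^+ 2 + (y (ordS i) - y i) ^+ 2),
        x (ordS i) - x i = rho i * cos (theta i + alpha i),
        y (ordS i) - y i = rho i * sin (theta i + alpha i)
      & eq_mod2pi (beta i) (theta i - theta (ordS i) - pi)].

(* With the index shifted to start at 0, (i - 1) pi becomes i pi. *)
Definition gamma beta (i : 'I_n) : R :=
  i%:R * pi - \sum_(j < n | (j < i)%N) beta j.

Definition g1 rho alpha beta : R :=
  \sum_(i < n) rho i * sin (alpha i + gamma beta i).

Definition g2 rho alpha beta : R :=
  \sum_(i < n) rho i * cos (alpha i + gamma beta i).

Definition g3 beta : R := \sum_(i < n) beta i + n%:R * pi.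

(* Cross product of z_i - c and the heading of unicycle i: positive when the
   heading points counterclockwise around c, negative when clockwise. *)
Definition turn (cx cy : R) x y theta (i : 'I_n) : R :=
  (x i - cx) * sin (theta i) - (y i - cy) * cos (theta i).

Definition counterclockwise cx cy x y theta : Prop :=
  forall i : 'I_n, 0 < turn cx cy x y theta i.

Definition clockwise cx cy x y theta : Prop :=
  forall i : 'I_n, turn cx cy x y theta i < 0.

Definition circular_formation_on (cx cy radius : R) x y theta : Prop :=
  [/\ 0 < radius,
      forall i : 'I_n, (x i - cx) ^+ 2 + (y i - cy) ^+ 2 = radius ^+ 2,
      forall i : 'I_n,
        (x i - cx) * cos (theta i) + (y i - cy) * sin (theta i) = 0
    & counterclockwise cx cy x y theta \/ clockwise cx cy x y theta].

Definition circular_formation x y theta : Prop :=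
  exists cx cy radius : R, circular_formation_on cx cy radius x y theta.

(* Since r^-1 = 0 when r = 0, r != 0 is the condition 1 / r <> 0. *)
Definition circle_conditions (r : R) rho alpha beta : Prop :=
  [/\ r != 0,
      forall i : 'I_n, eq_mod2pi (2 * alpha i + beta i) pi
    & forall i : 'I_n, 2 * sin (alpha i) / rho i = r^-1].

End Configuration.

(* Rate of change at time t of the polar angle of (x, y) around (cx, cy),
   positive when counterclockwise. *)
Definition angular_velocity (R : realType) (cx cy : R) (x y : R -> R) (t : R)
    : R :=
  ((x t - cx) * derive1 y t - (y t - cy) * derive1 x t)
    / ((x t - cx) ^+ 2 + (y t - cy) ^+ 2).

(* Main.v *)
Require Import Defs.
From HB Require Import structures.
From mathcomp Require Import all_boot all_order all_algebra.
From mathcomp Require Import all_classical all_reals all_analysis.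
From mathcomp Require Import zify ring lra.

Set Implicit Arguments.
Unset Strict Implicit.
Unset Printing Implicit Defensive.

Import Order.TTheory GRing.Theory Num.Theory.
Import numFieldNormedType.Exports.
Local Open Scope classical_set_scope.
Local Open Scope ring_scope.

(* Put a point of heading theta on a circle of signed radius r (positive when
   counterclockwise) at c + r (sin theta, - cos theta).  The chord from heading
   theta to heading phi = theta + delta then reads, in the frame of the first
   heading, rho (cos alpha, sin alpha) = r (sin delta, 1 - cos delta).  With
   rho > 0 and r <> 0 this is equivalent to 2 alpha = delta mod 2 pi together
   with 2 sin alpha / rho = 1 / r, and delta = - beta - pi.  So the conditions
   say exactly that the candidate centers z_i - r (sin theta_i, - cos theta_i)
   of consecutive unicycles coincide. *)

(** * Congruence modulo [2 * pi] and its detection by cosine and sine *)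

Section Congruence.
Variable R : realType.
Implicit Types a b c d : R.

Lemma eq_mod2pi_refl a : eq_mod2pi a a.
Proof. by exists 0; rewrite subrr mul0r. Qed.

Lemma eq_mod2piD a b c d :
  eq_mod2pi a b -> eq_mod2pi c d -> eq_mod2pi (a + c) (b + d).
Proof.
move=> [k abk] [l cdl]; exists (k + l).
by rewrite intrD mulrDl -abk -cdl; ring.
Qed.

Lemma eq_mod2piN a b : eq_mod2pi a b -> eq_mod2pi (- a) (- b).
Proof. by move=> [k abk]; exists (- k); rewrite rmorphN mulNr -abk; ring. Qed.

Lemma eq_mod2pi_sum n (a b : 'I_n -> R) :
  (forall i, eq_mod2pi (a i) (b i)) ->
  eq_mod2pi (\sum_(i < n) a i) (\sum_(i < n) b i).
Proof.
by move=> ab; apply: (big_ind2 (@eq_mod2pi R)) => *;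
  [exact: eq_mod2pi_refl | exact: eq_mod2piD | exact: ab].
Qed.

Lemma periodicz (f : R -> R) (T : R) :
  periodic f T -> forall (k : int) a, f (a + T *~ k) = f a.
Proof.
move=> fT [n|n] a; first exact: periodicn.
by rewrite NegzE mulrNz -[LHS](periodicn fT n.+1) subrK.
Qed.

Lemma eq_mod2pi_trig a b :
  eq_mod2pi a b <-> cos a = cos b /\ sin a = sin b.
Proof.
split=> [[k abk]|[cab sab]].
  have -> : a = b + pi *+ 2 *~ k.
    rewrite -mulrzl -mulr_natl -abk; ring.
  by rewrite (periodicz (@cosD2pi _)) (periodicz (@sinD2pi _)).
have cd1 : cos (a - b) = 1 by rewrite cosB cab sab -!expr2 cos2Dsin2.
have pi2 : 0 < 2 * pi :> R by rewrite mulr_gt0 ?pi_gt0.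
(* Adding [pi] before rounding down puts [a - b - e] in [-pi, pi), so its absolute value lies where
   [cos] is injective. *)
pose k := Num.floor ((a - b + pi) / (2 * pi)).
exists k; set e := k%:~R * (2 * pi).
have ek : e = pi *+ 2 *~ k by rewrite -mulrzl -mulr_natl.
have e1 : e <= a - b + pi by rewrite -ler_pdivlMr// floor_le.
have e2 : a - b + pi < e + 2 * pi.
  rewrite /e -{2}[2 * pi]mul1r -mulrDl -ltr_pdivrMr//.
  by have := floorD1_gt ((a - b + pi) / (2 * pi)); rewrite intrD.
suff: `|a - b - e| = 0 by move/normr0_eq0/subr0_eq.
apply: cos_inj; rewrite ?in_itv/= ?normr_ge0 ?lexx ?pi_ge0//=.
  by rewrite ler_norml; apply/andP; split; lra.
by rewrite cos_norm cos0 ek -mulrNz (periodicz (@cosD2pi _)).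
Qed.

Lemma eq_mod2pi_sym a b : eq_mod2pi a b -> eq_mod2pi b a.
Proof. by rewrite !eq_mod2pi_trig => -[-> ->]. Qed.

End Congruence.

(** * Chords of a circle of signed radius *)

Section Chord.
Variable R : realType.
Implicit Types r rho a theta phi : R.

(** Each side is the pair of real and imaginary parts of one complex equation; the second is the
    first multiplied by exp(- i theta). *)
Lemma chord_rotate r rho a theta phi :
  r * (sin phi - sin theta) = rho * cos (theta + a) /\
  r * (cos theta - cos phi) = rho * sin (theta + a) <->
  r * sin (phi - theta) = rho * cos a /\
  r * (1 - cos (phi - theta)) = rho * sin a.
Proof.
have cs := cos2Dsin2 theta.
split=> -[e1 e2].
  have aE : a = theta + a - theta by ring.
  have -> : cos a = cos (theta + a - theta) by rewrite -aE.
  have -> : sin a = sin (theta + a - theta) by rewrite -aE.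
  rewrite !sinB !cosB -cs; split.
    transitivity (cos theta * (rho * cos (theta + a)) +
                  sin theta * (rho * sin (theta + a))); last by ring.
    by rewrite -e1 -e2; ring.
  transitivity (cos theta * (rho * sin (theta + a)) -
                sin theta * (rho * cos (theta + a))); last by ring.
  by rewrite -e1 -e2; ring.
have phiE : phi = theta + (phi - theta) by ring.
have -> : cos phi = cos (theta + (phi - theta)) by rewrite -phiE.
have -> : sin phi = sin (theta + (phi - theta)) by rewrite -phiE.
rewrite !(cosD theta) !(sinD theta); split.
  transitivity (cos theta * (rho * cos a) - sin theta * (rho * sin a)).
    by rewrite -e1 -e2; ring.
  by ring.
transitivity (sin theta * (rho * cos a) + cos theta * (rho * sin a)).
  by rewrite -e1 -e2; ring.
by ring.
Qed.

(* Along a circle of signed radius r, turning the heading by delta moves the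
   point by 2 r sin (delta / 2) in the direction theta + delta / 2. *)
Lemma chord_conditionsP r rho a theta phi : 0 < rho -> r != 0 ->
  r * (sin phi - sin theta) = rho * cos (theta + a) /\
  r * (cos theta - cos phi) = rho * sin (theta + a) <->
  eq_mod2pi (2 * a) (phi - theta) /\ 2 * sin a / rho = r^-1.
Proof.
move=> rho_gt0 r0; have rho0 : rho != 0 by rewrite gt_eqF.
rewrite chord_rotate eq_mod2pi_trig mulr_natl cos_mulr2n sin_mulr2n.
have csd := cos2Dsin2 (phi - theta); have csa := cos2Dsin2 a.
move: (phi - theta) csd => d csd.
split=> [[e1 e2]|[[e1 e2] e3]].
  have ecos : cos a = r * sin d / rho by rewrite e1; field.
  have esin : sin a = r * (1 - cos d) / rho by rewrite e2; field.
  (* Squaring and adding [e1] and [e2] eliminates [a]. The three goals are then checked after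
     multiplication by the nonzero [rho ^+ 2]. *)
  have rho2 : rho ^+ 2 = 2 * r ^+ 2 * (1 - cos d).
    transitivity (rho ^+ 2 * (cos a ^+ 2 + sin a ^+ 2)).
      by rewrite csa mulr1.
    transitivity ((rho * cos a) ^+ 2 + (rho * sin a) ^+ 2); first by ring.
    rewrite -e1 -e2.
    transitivity (r ^+ 2 * (cos d ^+ 2 + sin d ^+ 2 + 1 - 2 * cos d)).
      by ring.
    by rewrite csd; ring.
  have rho20 : rho ^+ 2 != 0 by rewrite expf_neq0.
  split; first split.
  - apply: (mulfI rho20).
    transitivity (2 * (r * sin d) ^+ 2 - rho ^+ 2).
      by rewrite e1; ring.
    rewrite rho2 exprMn (sin2cos2 d); ring.
  - apply: (mulfI rho20).
    transitivity (2 * (r * sin d) * (r * (1 - cos d))).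
      by rewrite e1 e2; ring.
    by rewrite rho2; ring.
  - apply: (mulfI rho20); rewrite esin.
    transitivity (2 * r * (1 - cos d)); first by field.
    by rewrite rho2; field.
(* Solving for [rho] divides by [sin a], which is nonzero since [r^-1] is. *)
have rhoE : rho = 2 * r * sin a.
  have -> : r = (2 * sin a / rho)^-1 by rewrite e3 invrK.
  field; rewrite rho0 /=; apply/eqP => sin0; move/eqP: e3.
  by rewrite sin0 mulr0 mul0r eq_sym invr_eq0 (negPf r0).
rewrite -e1 -e2 rhoE; split; first by ring.
by rewrite cos2sin2; ring.
Qed.

End Chord.

(** * Circular formations as circles of signed radius *)

Section Formation.
Variables (R : realType) (n : nat).
Implicit Types x y theta rho alpha beta : 'I_n -> R.

(* r is the radius, signed positively for counterclockwise rotation. *)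
Definition signed_formation (cx cy r : R) x y theta : Prop :=
  forall i, x i - cx = r * sin (theta i) /\ y i - cy = - (r * cos (theta i)).

Lemma signed_formation_turn cx cy r x y theta i :
  signed_formation cx cy r x y theta -> turn cx cy x y theta i = r.
Proof.
move=> /(_ i)[ex ey]; rewrite /turn ex ey.
by rewrite -[RHS]mulr1 -(cos2Dsin2 (theta i)); ring.
Qed.

Lemma signed_formation_circular cx cy r x y theta :
  r != 0 -> signed_formation cx cy r x y theta ->
  circular_formation_on cx cy `|r| x y theta.
Proof.
move=> r0 sf; split.
- by rewrite normr_gt0.
- move=> i; have [-> ->] := sf i; rewrite real_normK ?num_real//.
  by rewrite -[RHS]mulr1 -(cos2Dsin2 (theta i)); ring.
- by move=> i; have [-> ->] := sf i; ring.
- move: r0; rewrite neq_lt => /orP[r0|r0]; [right|left] => i;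
  by rewrite (signed_formation_turn _ sf).
Qed.

(** By Lagrange's identity the square of [turn] plus the square of the tangency expression is
    [radius ^+ 2], so [turn] is plus or minus [radius]. The common orientation makes the sign the
    same for all unicycles, and this common value is [r]. *)
Lemma circular_formation_signed cx cy radius x y theta :
  circular_formation_on cx cy radius x y theta ->
  exists r, [/\ r != 0, `|r| = radius & signed_formation cx cy r x y theta].
Proof.
move=> [radius_gt0 on_circle tangent oriented].
have turn2 i : turn cx cy x y theta i ^+ 2 = radius ^+ 2.
  transitivity (turn cx cy x y theta i ^+ 2 +
      ((x i - cx) * cos (theta i) + (y i - cy) * sin (theta i)) ^+ 2).
    by rewrite tangent expr0n addr0.
  by rewrite -(on_circle i) -[RHS]mulr1 -(cos2Dsin2 (theta i)) /turn; ring.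
have [r [r0 rE turnE]] : exists r,
    [/\ r != 0, `|r| = radius & forall i, turn cx cy x y theta i = r].
  have radius0 : radius != 0 by rewrite gt_eqF.
  have normE : `|radius| = radius by rewrite gtr0_norm.
  case: oriented => o; [exists radius|exists (- radius)];
    (split; rewrite ?oppr_eq0 ?normrN// => i; have := o i;
     have /eqP := turn2 i; rewrite eqf_sqr => /orP[/eqP->|/eqP->] //; lra).
exists r; split=> // i; rewrite -(turnE i).
(* Resolve z_i - c in the heading frame: its component along the heading is 0, and along the
   right-hand normal it is [turn]. *)
have := tangent i; have := cos2Dsin2 (theta i); rewrite /turn.
set c := cos _; set s := sin _; set dx := x i - cx; set dy := y i - cy.
move=> cs t0; split.
  by rewrite -[LHS]mulr1 -cs -[LHS]subr0 -(mulr0 c) -t0; ring.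
by rewrite -[LHS]mulr1 -cs -[LHS]subr0 -(mulr0 s) -t0; ring.
Qed.

(** The step from the last index back to 0 is excluded, so [ordS i] has value [i.+1] without
    reduction; the recurrence for [gamma] relies on this. *)
Lemma ord_cycle_ind (P : 'I_n -> Prop) (i0 : 'I_n) :
  i0 = 0%N :> nat -> P i0 ->
  (forall i : 'I_n, (i.+1 < n)%N -> P i -> P (ordS i)) -> forall i, P i.
Proof.
move=> i0E P0 PS [m]; elim: m => [|m IHm] ltmn.
  by rewrite (_ : Ordinal ltmn = i0)//; apply: val_inj.
have := PS (Ordinal (ltnW ltmn)) ltmn (IHm _).
by congr P; apply: val_inj; rewrite /= modn_small.
Qed.

(** * The coordinate constraints *)

Variables x y theta rho alpha beta : 'I_n -> R.
Hypothesis coords : relative_coordinates x y theta rho alpha beta.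

(** The definition of [beta] telescopes, so [gamma beta i] is the heading of [i] relative to that of
    [i0]. *)
Lemma heading_gamma (i0 i : 'I_n) : i0 = 0%N :> nat ->
  eq_mod2pi (theta i) (theta i0 + gamma beta i).
Proof.
move=> i0E; move: i; apply: (ord_cycle_ind i0E) => [|i ltin IHi].
  rewrite /gamma i0E mul0r big_pred0 => [|j]; last by rewrite ltn0.
  by rewrite subrr addr0; exact: eq_mod2pi_refl.
have [_ _ _ _ beta_i] := coords i.
have -> : gamma beta (ordS i) = gamma beta i + pi - beta i.
  rewrite /gamma /= modn_small// (bigD1 i) ?ltnSn//=.
  rewrite (eq_bigl (fun j : 'I_n => (j < i)%N)) => [|j]; last first.
    by rewrite -(inj_eq val_inj) /=; lia.
  by rewrite -natr1; ring.
have {beta_i}[k kE] := eq_mod2piD IHi (eq_mod2piN (eq_mod2pi_sym beta_i)).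
(* Moving [pi] from one side of the congruence to the other costs one full turn. *)
exists (k - 1); rewrite intrD rmorphN mulrDl -kE /=; ring.
Qed.

Lemma sum_ordS_diff (f : 'I_n -> R) : \sum_(i < n) (f (ordS i) - f i) = 0.
Proof. by rewrite sumrB [X in _ - X](reindex_inj (@ordS_inj n)) subrr. Qed.

(** In the heading frame of [i0], [g1] and [g2] are the lateral and forward components of the sum of
    all chords z_(i+1) - z_i, which vanishes around the cycle. *)
Lemma g1_eq0 (i0 : 'I_n) : i0 = 0%N :> nat -> g1 rho alpha beta = 0.
Proof.
move=> i0E; rewrite /g1.
transitivity (\sum_(i < n) (cos (theta i0) * (y (ordS i) - y i) -
                            sin (theta i0) * (x (ordS i) - x i))).
  apply: eq_bigr => i _; have [_ _ ex ey _] := coords i.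
  have /eq_mod2pi_trig[_ <-] : eq_mod2pi (theta i + alpha i - theta i0)
      (alpha i + gamma beta i).
    have [k kE] := heading_gamma i i0E; exists k; rewrite -kE; ring.
  by rewrite sinB ex ey; ring.
by rewrite sumrB -!mulr_sumr !sum_ordS_diff !mulr0 subrr.
Qed.

Lemma g2_eq0 (i0 : 'I_n) : i0 = 0%N :> nat -> g2 rho alpha beta = 0.
Proof.
move=> i0E; rewrite /g2.
transitivity (\sum_(i < n) (cos (theta i0) * (x (ordS i) - x i) +
                            sin (theta i0) * (y (ordS i) - y i))).
  apply: eq_bigr => i _; have [_ _ ex ey _] := coords i.
  have /eq_mod2pi_trig[<- _] : eq_mod2pi (theta i + alpha i - theta i0)
      (alpha i + gamma beta i).
    have [k kE] := heading_gamma i i0E; exists k; rewrite -kE; ring.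
  by rewrite cosB ex ey; ring.
by rewrite big_split /= -!mulr_sumr !sum_ordS_diff !mulr0 addr0.
Qed.

Lemma g3_eq0 : eq_mod2pi (g3 beta) 0.
Proof.
have -> : 0 = \sum_(i < n) (theta i - theta (ordS i) - pi) + n%:R * pi.
  rewrite sumrB sumr_const card_ord mulr_natl subrK.
  rewrite -[RHS]opprK -sumrN.
  rewrite (eq_bigr (fun i => theta (ordS i) - theta i)) => [|i _].
    by rewrite sum_ordS_diff oppr0.
  by rewrite opprB.
apply: eq_mod2piD (eq_mod2pi_refl _); apply: eq_mod2pi_sum => i.
by have [] := coords i.
Qed.

(** * The conditions as coincidence of consecutive centers *)

Lemma circle_conditionsP (r : R) : r != 0 ->
  circle_conditions r rho alpha beta <->
  forall i, x (ordS i) - x i = r * (sin (theta (ordS i)) - sin (theta i)) /\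
            y (ordS i) - y i = r * (cos (theta i) - cos (theta (ordS i))).
Proof.
move=> r0.
(* Eliminating [beta] brings the angle condition to the form used in [chord_conditionsP]. *)
have angle i : eq_mod2pi (2 * alpha i + beta i) pi <->
    eq_mod2pi (2 * alpha i) (theta (ordS i) - theta i).
  have [_ _ _ _ bE] := coords i; split=> h.
    have [k kE] := eq_mod2piD h (eq_mod2piN bE).
    by exists (k + 1); rewrite intrD (mulrDl k%:~R) -kE; ring.
  have [k kE] := eq_mod2piD h bE.
  by exists (k - 1); rewrite intrD rmorphN (mulrDl k%:~R) -kE /=; ring.
split=> [[_ c1 c2] i|h].
  have [rho_gt0 _ -> -> _] := coords i.
  have /chord_conditionsP[] // := conj ((angle i).1 (c1 i)) (c2 i).
have c i : eq_mod2pi (2 * alpha i) (theta (ordS i) - theta i) /\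
    2 * sin (alpha i) / rho i = r^-1.
  have [rho_gt0 _ ex ey _] := coords i; have [ex' ey'] := h i.
  by apply/chord_conditionsP => //; rewrite -ex' -ey'.
by split=> // i; [apply/angle; exact: (c i).1|exact: (c i).2].
Qed.

Lemma signed_formation_conditions cx cy r : r != 0 ->
  signed_formation cx cy r x y theta -> circle_conditions r rho alpha beta.
Proof.
move=> r0 sf; apply/circle_conditionsP => // i.
have [ex ey] := sf i; have [ex' ey'] := sf (ordS i); split.
  by rewrite mulrBr -ex -ex'; ring.
by rewrite mulrBr -[r * _ - _]opprB opprD -ey' opprK; lra.
Qed.

Lemma circle_conditions_formation (i0 : 'I_n) r : i0 = 0%N :> nat ->
  circle_conditions r rho alpha beta ->
  exists cx cy, signed_formation cx cy r x y theta.
Proof.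
move=> i0E conds; have [r0 _ _] := conds.
have step := (circle_conditionsP r0).1 conds.
(* The candidate center of [i0]; each step of the cycle preserves it. *)
exists (x i0 - r * sin (theta i0)), (y i0 + r * cos (theta i0)) => i.
move: i; apply: (ord_cycle_ind i0E) => [|i _ [ex ey]]; first by split; ring.
have [ex' ey'] := step i; split.
  by rewrite -[x _](subrK (x i)) ex' -addrA ex; ring.
by rewrite -[y _](subrK (y i)) ey' -addrA ey; ring.
Qed.

Lemma circle_conditions_inj (i0 : 'I_n) r s :
  circle_conditions r rho alpha beta -> circle_conditions s rho alpha beta ->
  r = s.
Proof.
move=> [_ _ /(_ i0) er] [_ _ /(_ i0) es]; apply: invr_inj.
by rewrite -er -es.
Qed.

End Formation.

(** * Angular speed and heading rate on the circle *)

Section Kinematics.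
Variables (R : realType) (v : R) (x y theta omega : R -> R) (t : R).
Hypothesis dyn : unicycle_dynamics v x y theta omega t.
Variables cx cy r : R.
Hypothesis r0 : r != 0.
Hypotheses (ex : x t - cx = r * sin (theta t))
           (ey : y t - cy = - (r * cos (theta t))).

(** The velocity is tangent, so its cross product with z - c is [r * v], while the squared distance
    is [r ^+ 2]. *)
Lemma angular_velocity_tangent : angular_velocity cx cy x y t = v / r.
Proof.
have [dx dy _] := dyn.
rewrite /angular_velocity !derive1E !derive_val ex ey.
have -> : (r * sin (theta t)) ^+ 2 + (- (r * cos (theta t))) ^+ 2 = r ^+ 2.
  by rewrite -[RHS]mulr1 -(cos2Dsin2 (theta t)); ring.
apply: (canLR (mulfK _)); first by rewrite expf_neq0.
by rewrite -[v in RHS]mulr1 -(cos2Dsin2 (theta t)); field.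
Qed.

(* Differentiating the tangency relation at t yields v - r * omega t = 0. *)
Lemma heading_rate_tangent :
  (\forall s \near t, (x s - cx) * cos (theta s) + (y s - cy) * sin (theta s)
     = 0) ->
  omega t = v / r.
Proof.
move=> tangent; have [dx dy dth] := dyn.
pose F := (x - cst cx) * (cos \o theta) + (y - cst cy) * (sin \o theta).
have : 'D_1 F t = 'D_1 (cst 0) t by exact: near_eq_derive.
rewrite derive_cst derive_val /GRing.scale/= !fctE ex ey !subr0 => e.
have /subr0_eq -> : v - omega t * r = 0.
  by rewrite -[RHS]e -[LHS]mulr1 -(cos2Dsin2 (theta t)); ring.
by rewrite mulfK.
Qed.

End Kinematics.

Theorem proposition3 (R : realType) (n : nat) (n_ge2 : (2 <= n)%N)
    (v : R) (v_gt0 : 0 < v) (x y theta omega : 'I_n -> R -> R) (t : R)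
    (dyn : forall i : 'I_n,
       unicycle_dynamics v (x i) (y i) (theta i) (omega i) t)
    (no_overlap : without_overlap (x^~ t) (y^~ t))
    (rho alpha beta : 'I_n -> R)
    (coords : relative_coordinates (x^~ t) (y^~ t) (theta^~ t) rho alpha beta) :
  [/\ [/\ g1 rho alpha beta = 0, g2 rho alpha beta = 0
        & eq_mod2pi (g3 beta) 0],
      circular_formation (x^~ t) (y^~ t) (theta^~ t) <->
        (exists r : R, circle_conditions r rho alpha beta)
    & forall r cx cy radius : R,
        circle_conditions r rho alpha beta ->
        circular_formation_on cx cy radius (x^~ t) (y^~ t) (theta^~ t) ->
        [/\ `|r| = radius,
            0 < r -> counterclockwise cx cy (x^~ t) (y^~ t) (theta^~ t),
            r < 0 -> clockwise cx cy (x^~ t) (y^~ t) (theta^~ t),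
            forall i : 'I_n, angular_velocity cx cy (x i) (y i) t = v / r
          & (\forall s \near t,
               circular_formation_on cx cy radius
                 (x^~ s) (y^~ s) (theta^~ s)) ->
            forall i : 'I_n, omega i t = v / r]].
Proof.
pose i0 := Ordinal (ltnW n_ge2).
have i0E : i0 = 0%N :> nat by [].
split.
- by split; [exact: (g1_eq0 coords i0E)|exact: (g2_eq0 coords i0E)|
             exact: (g3_eq0 coords)].
- split=> [[cx [cy [radius /circular_formation_signed[r [r0 _ sf]]]]]|[r conds]].
    by exists r; apply: signed_formation_conditions sf.
  have [cx [cy sf]] := circle_conditions_formation coords i0E conds.
  exists cx, cy, `|r|; apply: signed_formation_circular sf.
  by case: conds.
move=> r cx cy radius conds /circular_formation_signed[s [s0 sE sf]].
have conds_s := signed_formation_conditions coords s0 sf.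
(* The signed radius [s] of the given circle also satisfies the conditions, so uniqueness identifies
   it with [r]. *)
have {s conds_s s0 sE sf}[r0 rE sf] : [/\ r != 0, `|r| = radius
    & signed_formation cx cy r (x^~ t) (y^~ t) (theta^~ t)].
  by rewrite (circle_conditions_inj i0 conds conds_s).
split=> //.
- by move=> r_gt0 i; rewrite (signed_formation_turn _ sf).
- by move=> r_lt0 i; rewrite (signed_formation_turn _ sf).
- by move=> i; have [ex ey] := sf i; exact: (angular_velocity_tangent (dyn i) r0 ex ey).
move=> near_formation i; have [ex ey] := sf i.
apply: (heading_rate_tangent (dyn i) r0 ex ey).
by near=> u; have [_ _ + _] : circular_formation_on cx cy radius
    (x^~ u) (y^~ u) (theta^~ u) by near: u.
Unshelve. all: by end_near. Qed.
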